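(* For $n\ge1$, let $G=F_n$ be the free group of rank $n$ and $N=[F_n,F_n]$ its commutator subgroup, with inclusion $i\colon N\hookrightarrow G$. Then \[ \dim\big(\mathrm{Q}(N)^G/i^*\mathrm{Q}(G)\big)=\frac{n(n-1)}{2}\quad\text{and}\quad\dim\big(\mathrm{Q}(N)^G/(\mathrm{H}^1(N)^G+i^*\mathrm{Q}(G))\big)=0. \]
   Context: A quasimorphism on a group $G$ is a function $f\colon G\to\mathbb{R}$ with $\sup_{x,y\in G}|f(xy)-f(x)-f(y)|<\infty$; it is homogeneous if $f(x^n)=n f(x)$ for all $x\in G$, $n\in\mathbb{Z}$. $\mathrm{Q}(G)$ is the real vector space of homogeneous quasimorphisms on $G$. For a normal subgroup $N$ of $G$ with inclusion $i$: $\mathrm{Q}(N)^G$ is the space of $f\in\mathrm{Q}(N)$ with $f(gxg^{-1})=f(x)$ for all $g\in G$, $x\in N$; $\mathrm{H}^1(N)^G$ is the subspace of $G$-invariant homomorphisms $N\to\mathbb{R}$; $i^*\mathrm{Q}(G)\subseteq\mathrm{Q}(N)^G$ is the space of restrictions to $N$ of elements of $\mathrm{Q}(G)$. Dimensions are over $\mathbb{R}$. *)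

(* Defs.v *)
From HB Require Import structures.
From mathcomp Require Import all_boot all_order all_algebra.
From mathcomp Require Import boolp classical_sets functions reals.
From mathcomp Require Import ring.

Set Implicit Arguments.
Unset Strict Implicit.
Unset Printing Implicit Defensive.

Import Order.TTheory GRing.Theory Num.Theory.

Local Open Scope ring_scope.

(* Letters are pairs (i, b): (i, false) is the generator x_i and (i, true) its
   inverse; the free group is carried by the reduced words. *)
Section FreeGroup.
Local Open Scope group_scope.
Variable n : nat.

Definition letter : Type := ('I_n * bool)%type.

Definition linv (a : letter) : letter := (a.1, ~~ a.2).

Definition reduced (w : seq letter) : bool :=
  sorted (fun a b => b != linv a) w.

Definition redcons (a : letter) (w : seq letter) : seq letter :=
  if w is b :: w' then (if b == linv a then w' else a :: w) else [:: a].

Definition rmul (u v : seq letter) : seq letter := foldr redcons v u.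

Definition rinv (w : seq letter) : seq letter := rev (map linv w).

Lemma linvK : involutive linv.
Proof. by case=> i b; rewrite /linv /= negbK. Qed.

Lemma reduced_tl a w : reduced (a :: w) -> reduced w.
Proof. by case: w => //= b w /andP[]. Qed.

Lemma reduced_redcons a w : reduced w -> reduced (redcons a w).
Proof.
case: w => [//|b w] rw /=; case: ifPn => [_|ne]; first exact: reduced_tl rw.
by rewrite /= ne; move: rw.
Qed.

Lemma reduced_rmul u v : reduced v -> reduced (rmul u v).
Proof. by move=> rv; elim: u => //= a u; apply: reduced_redcons. Qed.

Lemma reduced_rinv w : reduced w -> reduced (rinv w).
Proof.
rewrite /reduced /rinv rev_sorted sorted_map.
apply: sub_sorted => a b /=; apply: contraNneq => ->.
by rewrite linvK.
Qed.

Lemma redconsK a w : reduced w ->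
  redcons a (redcons (linv a) w) = w.
Proof.
case: w => [_|b w rw] /=; first by rewrite eqxx.
rewrite linvK; case: eqP => [eb|_] /=; last by rewrite eqxx.
subst b; case: w rw => //= c w /andP[ne _].
by rewrite (negPf ne).
Qed.

Lemma rmul_redcons a u v : reduced v ->
  rmul (redcons a u) v = redcons a (rmul u v).
Proof.
case: u => [//|b u] rv /=; case: eqP => [->|//].
by rewrite redconsK // reduced_rmul.
Qed.

Lemma rmulA u v w : reduced w -> rmul u (rmul v w) = rmul (rmul u v) w.
Proof.
by move=> rw; elim: u => //= a u ->; rewrite rmul_redcons.
Qed.

Lemma rmulw1 w : reduced w -> rmul w [::] = w.
Proof.
elim: w => //= a w IHw rw; rewrite (IHw (reduced_tl rw)).
by case: w rw {IHw} => //= b w /andP[/negPf->].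
Qed.

Lemma rmul_cat u v w : rmul (u ++ v) w = rmul u (rmul v w).
Proof. exact: foldr_cat. Qed.

Lemma rmulVw w : rmul (rinv w) w = [::].
Proof.
elim: w => //= a w IHw.
by rewrite /rinv map_cons rev_cons -cats1 rmul_cat /= linvK eqxx.
Qed.

Lemma rinvK : involutive rinv.
Proof.
move=> w; rewrite /rinv map_rev revK -map_comp -[RHS]map_id.
by apply: eq_map => a /=; rewrite linvK.
Qed.

Lemma rmulwV w : rmul w (rinv w) = [::].
Proof. by rewrite -{1}(rinvK w) rmulVw. Qed.

Definition free_group : Type := {w : seq letter | reduced w}.

HB.instance Definition _ := SubChoice.on free_group.

Definition fg_one : free_group := exist reduced [::] isT.
Definition fg_mul (u v : free_group) : free_group :=
  exist reduced (rmul (val u) (val v)) (reduced_rmul (val u) (valP v)).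
Definition fg_inv (u : free_group) : free_group :=
  exist reduced (rinv (val u)) (reduced_rinv (valP u)).

Lemma fg_mulA : associative fg_mul.
Proof. by move=> u v w; apply: val_inj; apply: rmulA (valP w). Qed.
Lemma fg_mul1 : left_id fg_one fg_mul.
Proof. by move=> u; apply: val_inj. Qed.
Lemma fg_mulr1 : right_id fg_one fg_mul.
Proof. by move=> u; apply: val_inj; apply: rmulw1 (valP u). Qed.
Lemma fg_mulV : left_inverse fg_one fg_inv fg_mul.
Proof. by move=> u; apply: val_inj; apply: rmulVw. Qed.
Lemma fg_mulrV : right_inverse fg_one fg_inv fg_mul.
Proof. by move=> u; apply: val_inj; apply: rmulwV. Qed.

HB.instance Definition _ := isGroup.Build free_group
  fg_mulA fg_mul1 fg_mulr1 fg_mulV fg_mulrV.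

Definition fg_gen (i : 'I_n) : free_group := exist reduced [:: (i, false)] isT.

Section Universal.
Variables (H : groupType) (y : 'I_n -> H).

Let letter_val (a : letter) : H := if a.2 then (y a.1)^-1 else y a.1.
Let word_val (w : seq letter) : H := foldr (fun a h => letter_val a * h) 1 w.

Let letter_valV a : letter_val (linv a) = (letter_val a)^-1.
Proof. by case: a => i []; rewrite /letter_val //= invgK. Qed.

Let word_val_redcons a w : word_val (redcons a w) = letter_val a * word_val w.
Proof.
case: w => //= b w; case: eqP => // ->.
by rewrite letter_valV mulgA mulgV mul1g.
Qed.

Let word_valM u v : word_val (rmul u v) = word_val u * word_val v.
Proof.
by elim: u => [|a u IHu] /=; rewrite ?mul1g // word_val_redcons IHu mulgA.
Qed.

Lemma free_group_universal : exists! f : free_group -> H,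
  {morph f : u v / u * v >-> u * v} /\ forall i, f (fg_gen i) = y i.
Proof.
exists (fun u => word_val (val u)); split.
  by split=> [u v|i]; [apply: word_valM | rewrite /= mulg1].
move=> f [fM fy]; apply/funext => -[w rw] /=.
have f1 : f 1 = 1 by apply: (mulgI (f 1)); rewrite -fM !mulg1.
have fV i : f (fg_gen i)^-1 = (y i)^-1.
  by apply: (mulgI (f (fg_gen i))); rewrite -fM !mulgV ?fy ?mulgV.
elim: w rw => [|a w IHw] rw /=.
  by rewrite -f1; congr f; apply: val_inj.
rewrite (IHw (reduced_tl rw)).
have -> : letter_val a = f (exist reduced [:: a] isT).
  case: a rw => i [] rw; rewrite /letter_val /= -?fV -?fy; congr f;
  exact: val_inj.
rewrite -fM; congr f; apply: val_inj => /=.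
by case: w rw {IHw} => //= b w /andP[/negPf->].
Qed.
End Universal.

End FreeGroup.

Section Subgroup.
Local Open Scope group_scope.
Variable G : groupType.

Definition zpow (x : G) (k : int) : G :=
  match k with Posz m => x ^+ m | Negz m => x ^- m.+1 end.

Section SubgroupType.
Variable N : groupClosed G.

Definition subgroup : Type := {x : G | x \in N}.

HB.instance Definition _ := SubChoice.on subgroup.

Lemma subgroup_closed : group_closed (fun x : G => x \in N).
Proof. by split; [apply: gpred1 | move=> x y xN yN; apply: gpredF]. Qed.

HB.instance Definition _ :=
  SubChoice_isSubGroup.Build G (fun x => x \in N) subgroup subgroup_closed.
End SubgroupType.

Definition commutator_pred : {pred G} := fun x =>
  `[< forall S : groupClosed G, (forall y z : G, [~ y, z] \in S) -> x \in S >].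

Lemma commutator_pred_closed : group_closed commutator_pred.
Proof.
split=> [|x y /asboolP xN /asboolP yN]; apply/asboolP => S SR.
  exact: gpred1.
by apply: gpredF; [apply: xN | apply: yN].
Qed.

HB.instance Definition _ := isMulClosed.Build G commutator_pred
  (group_closedM commutator_pred_closed).
HB.instance Definition _ := isMul1Closed.Build G commutator_pred
  commutator_pred_closed.1.
HB.instance Definition _ := isInvClosed.Build G commutator_pred
  (group_closedV commutator_pred_closed).

Definition commutator_subgroup : groupClosed G := commutator_pred.
End Subgroup.

Section LinearAlgebra.
Variables (R : fieldType) (V : lmodType R).

Definition has_dim (d : nat) : Prop :=
  exists b : 'I_d -> V,
    (forall c : 'I_d -> R, \sum_i c i *: b i = 0 -> forall i, c i = 0) /\
    (forall v : V, exists c : 'I_d -> R, v = \sum_i c i *: b i).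

Section Sum.
Variables U W : submodClosed V.

Definition sumsp : {pred V} := fun v =>
  `[< exists u w, [/\ u \in U, w \in W & v = u + w] >].

Lemma sumsp_closed : submod_closed sumsp.
Proof.
split=> [|a x y /asboolP[u [w [uU wW ->]]] /asboolP[u' [w' [uU' wW' ->]]]].
  by apply/asboolP; exists 0, 0; rewrite !rpred0 addr0.
apply/asboolP; exists (a *: u + u'), (a *: w + w'); split.
- by rewrite rpredD ?rpredZ.
- by rewrite rpredD ?rpredZ.
- by rewrite scalerDr addrACA.
Qed.

HB.instance Definition _ := GRing.isSubmodClosed.Build R V sumsp sumsp_closed.
End Sum.

Section Quotient.
Local Open Scope quotient_scope.
Variable W : submodClosed V.

(* The library only makes zmodType quotients, by a zmodClosed predicate. *)
Definition zmod_of : {pred V} := W.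

HB.instance Definition _ := GRing.isZmodClosed.Build V zmod_of
  (GRing.submod_closedB (GRing.submodClosedP W)).

Definition quotsp : Type := {ideal_quot zmod_of}.

HB.instance Definition _ := GRing.Zmodule.on quotsp.

Definition quotsp_pi (v : V) : quotsp := \pi_{ideal_quot zmod_of} v.

Lemma quotsp_piP (x : quotsp) : exists v, x = quotsp_pi v.
Proof. by exists (repr (x : {ideal_quot zmod_of})); rewrite /quotsp_pi reprK. Qed.

Lemma quotsp_piE u v : (quotsp_pi u = quotsp_pi v) <-> (u - v \in W).
Proof.
have -> : (u - v \in W) = (u == v %[mod {ideal_quot zmod_of}]).
  by rewrite -Quotient.idealrBE.
by split=> /eqP.
Qed.

Lemma quotsp_piD : {morph quotsp_pi : u v / u + v}.
Proof. exact: (raddfD (\pi_{ideal_quot zmod_of})). Qed.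

Definition quotsp_scale (a : R) (x : quotsp) : quotsp :=
  quotsp_pi (a *: repr (x : {ideal_quot zmod_of})).

Lemma quotsp_scale_pi a v : quotsp_scale a (quotsp_pi v) = quotsp_pi (a *: v).
Proof.
apply/quotsp_piE; rewrite -scalerBr; apply: rpredZ.
by apply/quotsp_piE; rewrite /quotsp_pi reprK.
Qed.

Lemma quotsp_scaleA a b x :
  quotsp_scale a (quotsp_scale b x) = quotsp_scale (a * b) x.
Proof. by case: (quotsp_piP x) => v ->; rewrite !quotsp_scale_pi scalerA. Qed.
Lemma quotsp_scale1 : left_id 1 quotsp_scale.
Proof.
by move=> x; case: (quotsp_piP x) => v ->; rewrite quotsp_scale_pi scale1r.
Qed.
Lemma quotsp_scaleDr : right_distributive quotsp_scale +%R.
Proof.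
move=> a x y; case: (quotsp_piP x) => u ->; case: (quotsp_piP y) => v ->.
by rewrite -quotsp_piD !quotsp_scale_pi scalerDr quotsp_piD.
Qed.
Lemma quotsp_scaleDl x : {morph quotsp_scale^~ x : a b / a + b}.
Proof.
move=> a b; case: (quotsp_piP x) => v ->.
by rewrite !quotsp_scale_pi scalerDl quotsp_piD.
Qed.

HB.instance Definition _ := GRing.Zmodule_isLmodule.Build R quotsp
  quotsp_scaleA quotsp_scale1 quotsp_scaleDr quotsp_scaleDl.

Lemma quotsp_piZ a v : quotsp_pi (a *: v) = a *: quotsp_pi v.
Proof. by rewrite -quotsp_scale_pi. Qed.
End Quotient.
End LinearAlgebra.

Section Quasimorphisms.
Variable R : realType.

Definition quasimorphism (G : groupType) (f : G -> R) : Prop :=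
  exists D : R, forall x y : G, `|f (x * y)%g - f x - f y| <= D.

Definition homogeneous (G : groupType) (f : G -> R) : Prop :=
  forall (x : G) (k : int), f (zpow x k) = k%:~R * f x.

(* Q(G); the codomain R^o is R as a vector space over itself. *)
Definition hqm (G : groupType) : {pred G -> R^o} := fun f =>
  `[< quasimorphism f /\ homogeneous f >].

Lemma hqm_closed (G : groupType) : submod_closed (@hqm G).
Proof.
split=> [|a f g /asboolP[[D fD] fh] /asboolP[[M gM] gh]].
  apply/asboolP; split=> [|x k]; last by rewrite mulr0.
  by exists 0 => x y; rewrite /= !subrr normr0.
have E z : (a *: f + g) z = a * f z + g z by [].
apply/asboolP; split; last first.
  by move=> x k; rewrite !E fh gh mulrDr; congr (_ + _); rewrite mulrCA.
exists (`|a| * D + M) => x y.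
have -> : (a *: f + g) (x * y)%g - (a *: f + g) x - (a *: f + g) y =
  a * (f (x * y)%g - f x - f y) + (g (x * y)%g - g x - g y).
  rewrite !E !mulrBr.
  by rewrite [RHS]addrACA [a * f _ - _ + _]addrACA -!opprD.
by rewrite (le_trans (ler_normD _ _)) // lerD // normrM ler_wpM2l.
Qed.

HB.instance Definition _ (G : groupType) :=
  GRing.isSubmodClosed.Build R (G -> R^o) (@hqm G) (@hqm_closed G).

Variables (G : groupType) (N : groupClosed G).

(* Quantifying over y = g x g^-1 in N makes sense of f (g x g^-1) without a
   proof that N is normal. *)
Definition invariant (f : subgroup N -> R) : Prop :=
  forall (g : G) (x y : subgroup N),
    val y = (g * val x * g^-1)%g -> f y = f x.

Definition invariant_hqm : {pred subgroup N -> R^o} := fun f =>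
  (f \in @hqm (subgroup N)) && `[< invariant f >].

Lemma invariant_hqm_closed : submod_closed invariant_hqm.
Proof.
split=> [|a f g /andP[fQ /asboolP fi] /andP[gQ /asboolP gi]].
  by apply/andP; split; [apply: rpred0 | apply/asboolP].
apply/andP; split; first by apply: rpredD => //; apply: rpredZ.
apply/asboolP => h x y e.
have E z : (a *: f + g) z = a * f z + g z by [].
by rewrite !E (fi h x y e) (gi h x y e).
Qed.

HB.instance Definition _ := GRing.isSubmodClosed.Build R (subgroup N -> R^o)
  invariant_hqm invariant_hqm_closed.

(* Q(N)^G *)
Definition QNG : Type := {f : subgroup N -> R^o | f \in invariant_hqm}.

HB.instance Definition _ := SubChoice.on QNG.
HB.instance Definition _ :=
  GRing.SubChoice_isSubLmodule.Build R _ (fun f => f \in invariant_hqm) QNG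
    (GRing.subsemimodClosedP invariant_hqm).

Definition invariant_hom (f : subgroup N -> R) : Prop :=
  (forall x y : subgroup N, f (x * y)%g = f x + f y) /\ invariant f.

Lemma invariant_hom_hqm (f : subgroup N -> R) :
  invariant_hom f -> f \in invariant_hqm.
Proof.
move=> [fM fi]; apply/andP; split; apply/asboolP => //.
have f1 : f 1%g = 0 by apply: (addrI (f 1%g)); rewrite -fM mulg1 addr0.
have fV x : f x^-1%g = - f x.
  by apply/eqP; rewrite -addr_eq0 -fM mulVg f1.
have fX x m : f (x ^+ m)%g = m%:R * f x.
  elim: m => [|m IHm]; first by rewrite mul0r.
  by rewrite expgS fM IHm -(addn1 m) natrD mulrDl mul1r addrC.
split; first by exists 0 => x y; rewrite fM -addrA -opprD subrr normr0.
move=> x [m|m]; rewrite /zpow; first by rewrite fX.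
by rewrite fV fX NegzE mulrNz mulNr.
Qed.

(* H^1(N)^G, as a subspace of Q(N)^G: by invariant_hom_hqm no invariant
   homomorphism is lost. *)
Definition H1NG : {pred QNG} := fun f => `[< invariant_hom (val f) >].

Lemma H1NG_closed : submod_closed H1NG.
Proof.
split=> [|a f g /asboolP[fM fi] /asboolP[gM gi]]; apply/asboolP; split=> //.
- by move=> x y; rewrite /= addr0.
- have E z : val (a *: f + g) z = a * val f z + val g z by [].
  by move=> x y; rewrite !E fM gM mulrDr addrACA.
- have E z : val (a *: f + g) z = a * val f z + val g z by [].
  by move=> h x y e; rewrite !E (fi h x y e) (gi h x y e).
Qed.

HB.instance Definition _ := GRing.isSubmodClosed.Build R QNG H1NG H1NG_closed.

Lemma hqm_conj (h : G -> R) (g x : G) :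
  h \in @hqm G -> h (g * x * g^-1)%g = h x.
Proof.
move=> /asboolP[[D hD] hh]; apply/eqP; rewrite -subr_eq0 -normr_le0.
set d := `|_|.
have hX z m : h (z ^+ m)%g = m%:R * h z by exact: (hh z (Posz m)).
have conjX m : ((g * x * g^-1) ^+ m)%g = (g * x ^+ m * g^-1)%g.
  elim: m => [|m IHm]; first by rewrite mulg1 mulgV.
  by rewrite !expgS IHm !mulgA mulgVK.
have dm m : m%:R * d <= D + D + `|h g + h g^-1%g|.
  rewrite -[m%:R]normr_nat -normrM mulrBr -!hX conjX.
  have -> : h (g * x ^+ m * g^-1)%g - h (x ^+ m)%g =
    (h (g * x ^+ m * g^-1)%g - h (g * x ^+ m)%g - h g^-1%g) +
    (h (g * x ^+ m)%g - h g - h (x ^+ m)%g) + (h g + h g^-1%g) by ring.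
  by do 2!rewrite (le_trans (ler_normD _ _)) ?lerD //.
rewrite leNgt; apply/negP => d0.
set C := _ + `|_| in dm.
have := archi_boundP (divr_ge0 (le_trans (mulr_ge0 (ler0n _ 0) (ltW d0)) (dm 0%N)) (ltW d0)).
by rewrite ltr_pdivrMr // ltNge dm.
Qed.

Lemma hqm_res (h : G -> R) : h \in @hqm G -> h \o val \in invariant_hqm.
Proof.
move=> hQ; apply/andP; split; apply/asboolP; last first.
  by move=> g x y /= ->; apply: hqm_conj.
move: hQ => /asboolP[[D hD] hh]; split; first by exists D => x y; apply: hD.
have vX (x : subgroup N) m : val (x ^+ m)%g = (val x ^+ m)%g.
  by elim: m => // m IHm; rewrite !expgS -IHm.
by move=> x [] m; rewrite /= -hh /zpow /= ?vX // -vX.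
Qed.

(* i^* Q(G), as a subspace of Q(N)^G: by hqm_res no restriction is lost. *)
Definition iQG : {pred QNG} := fun f =>
  `[< exists2 h : G -> R, h \in @hqm G & val f = h \o val >].

Lemma iQG_closed : submod_closed iQG.
Proof.
split=> [|a f g /asboolP[h hQ fE] /asboolP[k kQ gE]]; apply/asboolP.
  by exists (0 : G -> R^o); [apply: rpred0 | apply/funext].
exists (a *: (h : G -> R^o) + k); first by apply: rpredD => //; apply: rpredZ.
apply/funext => x.
have -> : val (a *: f + g) x = a * val f x + val g x by [].
by rewrite fE gE.
Qed.

HB.instance Definition _ := GRing.isSubmodClosed.Build R QNG iQG iQG_closed.
End Quasimorphisms.

Arguments commutator_subgroup G : clear implicits.
Arguments H1NG R {G} N.
Arguments iQG R {G} N.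

(* Main.v *)
Require Import Defs.
From HB Require Import structures.
From mathcomp Require Import all_boot all_order all_algebra.
From mathcomp Require Import boolp classical_sets functions reals.
From mathcomp Require Import ring lra zify.
Import Order.TTheory GRing.Theory Num.Theory.

Set Implicit Arguments.
Unset Strict Implicit.
Unset Printing Implicit Defensive.

Local Open Scope ring_scope.

(* Let f in Q(N)^G, with N = [G, G].  By invariance f([y, z]) is
   quasi-additive in y and in z, so f([x_k^a, x_l^b]) = lam_kl a b + O(1); the
   lam_kl are removed by subtracting a combination of the G-invariant
   homomorphisms on N given by the Magnus coefficients of X_k X_l, k < l.  Once
   all f([x_k^a, x_l^b]) are bounded, f is bounded on the elements
   s(a) s(b) s(a + b)^-1 of N, where s(a) = x_1^(a_1) ... x_n^(a_n) is the
   section of the abelianization e : G -> Z^n.  Hence g |-> f(g s(e(g))^-1) is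
   a quasimorphism on G extending f, and its homogenization still extends f.
   Conversely, if sum lam_kl c_kl is the restriction of h in Q(G), then
   lam_kl m^2 = h([x_k^m, x_l^m]) is bounded in m, so that lam_kl = 0. *)

(** * Sequences and functions of integers that are additive up to a bounded error *)

Section Asymptotics.
Variable R : realType.

(** The Archimedean property; each use turns an estimate up to a bounded error into an exact
    identity. *)
Lemma bounded_multiples_eq0 (x C : R) :
  (forall m : nat, m%:R * `|x| <= C) -> x = 0.
Proof.
move=> xC; apply/eqP; apply: contraT => x0.
have x_gt0 : 0 < `|x| by rewrite normr_gt0.
have C0 : 0 <= C by rewrite (le_trans _ (xC 0%N)) // mul0r.
have := archi_boundP (divr_ge0 C0 (ltW x_gt0)).
by rewrite ltr_pdivrMr // ltNge xC.
Qed.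

Definition quasiadditive (u : nat -> R) (D : R) :=
  forall m k, `|u (m + k)%N - u m - u k| <= D.

Lemma quasiadditive_muln u D m k : quasiadditive u D ->
  `|u (m * k.+1)%N - k.+1%:R * u m| <= k%:R * D.
Proof.
move=> uD; elim: k => [|k IHk]; first by rewrite muln1 mul1r subrr mul0r normr0.
rewrite mulnS.
have := ler_normD (u (m + m * k.+1)%N - u m - u (m * k.+1)%N)
  (u (m * k.+1)%N - k.+1%:R * u m).
rewrite -[k.+2%:R]natr1 -[X in _ -> _ <= X * _]natr1.
set a := k.+1%:R; set x := u (m + _)%N; set y := u (m * _)%N.
have -> : x - u m - y + (y - a * u m) = x - (a + 1) * u m by ring.
move/le_trans; apply.
have := uD m (m * k.+1)%N; rewrite -/x -/y => h.
by rewrite mulrDl mul1r addrC lerD.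
Qed.

(** Both products are compared with [u (m.+1 * k.+1)], at a cost of [k * D] and [m * D]. The larger
    constant is the one that rearranges to [(u m.+1 - D) / m.+1 <= (u k.+1 + D) / k.+1]. *)
Lemma quasiadditive_cross u D m k : quasiadditive u D ->
  k.+1%:R * u m.+1 - m.+1%:R * u k.+1 <= (k.+1%:R + m.+1%:R) * D.
Proof.
move=> uD; have := quasiadditive_muln m.+1 k uD.
have := quasiadditive_muln k.+1 m uD; rewrite (mulnC k.+1).
rewrite !ler_norml => /andP[_ h1] /andP[h2 _].
have D0 : 0 <= D := le_trans (normr_ge0 _) (uD 0%N 0%N).
rewrite -!natr1 in h1 h2 *.
by lra.
Qed.

Lemma quasiadditive_slope u D : quasiadditive u D ->
  exists mu, forall m, `|u m - m%:R * mu| <= D.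
Proof.
move=> uD.
(* Every [(u m - D) / m] is below every [(u k + D) / k], by comparing both with
   [u (m * k)]: the slope is any real in between. *)
pose S := [set (u m.+1 - D) / m.+1%:R | m in [set: nat]]%classic.
have Sub k : ubound S ((u k.+1 + D) / k.+1%:R).
  move=> _ [m _ <-]; rewrite ler_pdivrMr ?ltr0Sn // mulrAC.
  rewrite ler_pdivlMr ?ltr0Sn //.
  by have := quasiadditive_cross m k uD; lra.
have hS : has_sup S.
  by split; [exists ((u 1%N - D) / 1); exists 0%N | eexists; apply: (Sub 0%N)].
exists (sup S) => -[|m].
  rewrite mul0r subr0 -normrN; apply: le_trans (uD 0%N 0%N).
  by rewrite addn0 subrr add0r.
have h1 : (u m.+1 - D) / m.+1%:R <= sup S.
  by apply: sup_upper_bound => //; exists m.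
have h2 : sup S <= (u m.+1 + D) / m.+1%:R.
  by apply: ge_sup (Sub m); case: hS.
rewrite ler_pdivrMr ?ltr0Sn // in h1; rewrite ler_pdivlMr ?ltr0Sn // in h2.
by rewrite ler_norml; apply/andP; split; lra.
Qed.

Lemma additive_intE (q : int -> R) :
  (forall a b, q (a + b) = q a + q b) -> forall a, q a = a%:~R * q 1.
Proof.
move=> qD; have q0 : q 0 = 0 by apply: (addrI (q 0)); rewrite -qD !addr0.
have qN a : q (- a) = - q a by apply/eqP; rewrite -addr_eq0 -qD addNr q0.
have qn (m : nat) : q m = m%:R * q 1.
  elim: m => [|m IHm]; first by rewrite q0 mul0r.
  by rewrite -addn1 PoszD qD IHm natrD mulrDl mul1r.
by case=> m; [rewrite qn | rewrite NegzE qN qn mulrNz mulNr].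
Qed.

(** [lam] is [mu 1], where [mu b] is the slope of [B^~ b] on [nat]. The second estimate makes [mu]
    additive up to an error all of whose multiples are bounded, so [mu] is exactly additive, hence
    linear. *)
Lemma quasibilinear_int (B : int -> int -> R) D :
  (forall a a' b, `|B (a + a') b - B a b - B a' b| <= D) ->
  (forall a b b', `|B a (b + b') - B a b - B a b'| <= D) ->
  exists lam, exists K, forall a b, `|B a b - lam * a%:~R * b%:~R| <= K.
Proof.
move=> Bl Br.
have qB b : quasiadditive (fun m => B m%:Z b) D.
  by move=> m k; rewrite PoszD; apply: Bl.
have [mu muP] := choice (fun b => quasiadditive_slope (qB b)).
have muD b b' : mu (b + b') = mu b + mu b'.
  apply/eqP; rewrite -subr_eq0; apply/eqP.
  apply: (@bounded_multiples_eq0 _ (4 * D)) => m.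
  rewrite -[m%:R]normr_nat -normrM.
  have := Br m b b'; have := muP b m; have := muP b' m; have := muP (b + b') m.
  by rewrite !ler_norml => /andP[? ?] /andP[? ?] /andP[? ?] /andP[? ?];
    apply/andP; split; lra.
exists (mu 1), (3 * D) => a b.
rewrite -mulrA (mulrC (mu 1)) -mulrA -(additive_intE muD).
have D0 : 0 <= D := le_trans (normr_ge0 _) (Bl 0 0 0).
case: a => m; first by have := muP b m => /= h; apply: (le_trans h); lra.
(* For negative [a], [B a b] is compared with [B 0 b - B (- a) b]; each of the three estimates costs
   one [D]. *)
have := Bl (Negz m) m.+1 b; have := muP b m.+1; have := muP b 0%N.
rewrite NegzE addNr mulrNz -pmulrn.
by rewrite !ler_norml => /andP[? ?] /andP[? ?] /andP[? ?];
  apply/andP; split; lra.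
Qed.
End Asymptotics.

(** * Exponent law for integer powers *)

Section IntegerPowers.
Local Open Scope group_scope.
Variable G : groupType.
Implicit Type x : G.

Lemma zpowSr x (a : int) : zpow x (a + 1)%R = zpow x a * x.
Proof.
case: a => [m|[|m]]; first by rewrite -PoszD addn1 /= expgSr.
  by rewrite /= expg1 mulVg.
have -> : (Negz m.+1 + 1 = Negz m)%R by lia.
by rewrite /= [x ^+ m.+2]expgS invgM mulgVK.
Qed.

Lemma zpowD x (a b : int) : zpow x (a + b)%R = zpow x a * zpow x b.
Proof.
elim: b => [|m IHm|m IHm]; first by rewrite addr0 mulg1.
  by rewrite -addn1 PoszD addrA !zpowSr IHm mulgA.
apply: (mulIg x); rewrite -mulgA -!zpowSr.
have -> : (- m.+1%:Z + 1 = - m%:Z)%R by lia.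
by rewrite -IHm; congr zpow; lia.
Qed.
End IntegerPowers.

(** * Homogenization, and values of homogeneous quasimorphisms on commutators *)

Section Homogenization.
Variables (R : realType) (G : groupType).

(** [h x] is the slope of [m |-> f (x ^+ m)], with an error uniform in [x]. Homogeneity holds
    because all multiples of each discrepancy are bounded; the case [m = 1] puts [h] within [D] of
    [f], so [h] is a quasimorphism too. *)
Lemma quasimorphism_near_hqm (f : G -> R) : quasimorphism f ->
  exists2 h : G -> R, h \in @hqm R G &
    exists D, forall x (m : nat), `|f (x ^+ m)%g - m%:R * h x| <= D.
Proof.
move=> [D fD].
have qf x : quasiadditive (fun m => f (x ^+ m)%g) D.
  by move=> m k; rewrite expgnDr; apply: fD.
have [h hD] := choice (fun x => quasiadditive_slope (qf x)).
exists h; last by exists D.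
have near x : `|f x - h x| <= D by have := hD x 1%N; rewrite mul1r expg1.
have hX x k : h (x ^+ k)%g = k%:R * h x.
  apply/eqP; rewrite -subr_eq0; apply/eqP.
  apply: (@bounded_multiples_eq0 _ _ (2 * D)) => m.
  rewrite -[m%:R]normr_nat -normrM.
  have := hD (x ^+ k)%g m; have := hD x (k * m)%N; rewrite expgnA natrM.
  by rewrite !ler_norml => /andP[? ?] /andP[? ?];
    apply/andP; split; lra.
have hV x : h x^-1%g = - h x.
  apply/eqP; rewrite -addr_eq0; apply/eqP.
  apply: (@bounded_multiples_eq0 _ _ (3 * D + `|f 1%g|)) => m.
  rewrite -[m%:R]normr_nat -normrM.
  have := hD x^-1%g m; have := hD x m; have := fD (x ^- m)%g (x ^+ m)%g.
  have := lexx `|f 1%g|.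
  rewrite mulVg expVgn !ler_norml.
  by move=> /andP[? ?] /andP[? ?] /andP[? ?] /andP[? ?];
    apply/andP; split; lra.
apply/asboolP; split; last first.
  move=> x [m|m]; rewrite /zpow; first by rewrite hX.
  by rewrite hV hX NegzE mulrNz mulNr.
exists (4 * D) => x y.
have := near (x * y)%g; have := near x; have := near y; have := fD x y.
rewrite !ler_norml.
by move=> /andP[? ?] /andP[? ?] /andP[? ?] /andP[? ?];
  apply/andP; split; lra.
Qed.

Lemma hqmX (h : G -> R) x m : h \in @hqm R G -> h (x ^+ m)%g = m%:R * h x.
Proof. by move=> /asboolP[_ hh]; apply: (hh x (Posz m)). Qed.

Lemma hqmV (h : G -> R) x : h \in @hqm R G -> h x^-1%g = - h x.
Proof.
by move=> /asboolP[_ hh]; have := hh x (Negz 0); rewrite /= expg1 mulN1r.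
Qed.

(** Conjugation invariance gives [h (x * y) = h (y * x)], so only the defect of [h] is left. *)
Lemma hqm_comm_bounded (h : G -> R) : h \in @hqm R G ->
  exists D, forall x y : G, `|h (x * y / (y * x))%g| <= D.
Proof.
move=> hQ; have /asboolP[[D hD] _] := hQ; exists D => x y.
have := hD (x * y)%g (y * x)^-1%g; rewrite hqmV //.
have <- : h (y * x)%g = h (x * y)%g.
  by have := hqm_conj y (x * y)%g hQ; rewrite !mulgA mulgK.
by rewrite opprK subrK.
Qed.
End Homogenization.

(** * Congruence modulo [N] with control of [F], and ordered products of powers *)

Section CoarseEquality.
Variables (R : realFieldType) (G : groupType) (N : groupClosed G).
Variables (F : G -> R) (D : R).
Hypothesis Nconj : forall g x, x \in N -> (g * x * g^-1)%g \in N.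
Hypothesis FM : forall x y, x \in N -> y \in N ->
  `|F (x * y)%g - F x - F y| <= D.
Hypothesis FJ : forall g x, x \in N -> F (g * x * g^-1)%g = F x.
Hypothesis FV : forall x, x \in N -> F x^-1%g = - F x.

(** A coarse equivalence: translations on either side preserve [K], and composing two steps adds
    their constants and one [D]. *)
Definition close (K : R) (u v : G) := (u / v)%g \in N /\ `|F (u / v)%g| <= K.

Lemma close_refl u : close 0 u u.
Proof.
rewrite /close mulgV; split; first exact: gpred1.
have := FV (gpred1 : 1%g \in N); rewrite invg1 => /eqP.
by rewrite -addr_eq0 -mulr2n mulrn_eq0 /= => /eqP ->; rewrite normr0.
Qed.

Lemma close_sym K u v : close K u v -> close K v u.
Proof. by case=> uv FK; rewrite /close -invgF FV // normrN gpredV. Qed.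

Lemma close_trans K K' v u w :
  close K u v -> close K' v w -> close (K + K' + D) u w.
Proof.
move=> [uv FK] [vw FK'].
have E : (u / w = (u / v) * (v / w))%g by rewrite mulgA mulgVK.
rewrite /close E; split; first exact: gpredM.
have := FM uv vw; move: FK FK'; rewrite !ler_norml.
by move=> /andP[? ?] /andP[? ?] /andP[? ?];
  apply/andP; split; lra.
Qed.

Lemma close_mull K g u v : close K u v -> close K (g * u)%g (g * v)%g.
Proof.
move=> [uv FK]; have E : ((g * u) / (g * v) = g * (u / v) * g^-1)%g.
  by rewrite invgM !mulgA.
rewrite /close E; split; first exact: Nconj.
by rewrite FJ.
Qed.

Lemma close_mulr K g u v : close K u v -> close K (u * g)%g (v * g)%g.
Proof. by rewrite /close mulgKA. Qed.

Variables (I : Type) (x : I -> G).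
Hypothesis comm_close : forall i j, exists K, forall a b : int,
  close K (zpow (x i) a * zpow (x j) b)%g (zpow (x j) b * zpow (x i) a)%g.

Definition ordered_prod (l : seq I) (a : I -> int) : G :=
  \big[*%g/1%g]_(i <- l) zpow (x i) (a i).

(** The power is moved past one factor of the product at a time. *)
Lemma zpow_ordered_prod_close l i : exists K, forall (c : int) a,
  close K (zpow (x i) c * ordered_prod l a)%g
          (ordered_prod l a * zpow (x i) c)%g.
Proof.
rewrite /ordered_prod; elim: l => [|j l [K IHl]].
  by exists 0 => c a; rewrite big_nil mulg1 mul1g; apply: close_refl.
have [K' cK'] := comm_close i j.
exists (K' + K + D) => c a; rewrite big_cons.
apply: (@close_trans _ _
  (zpow (x j) (a j) * zpow (x i) c * ordered_prod l a)%g).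
  by rewrite mulgA; apply: close_mulr.
rewrite -!mulgA; apply: close_mull; exact: IHl.
Qed.

Lemma ordered_prodD_close l : exists K, forall a b : I -> int,
  close K (ordered_prod l a * ordered_prod l b)%g
          (ordered_prod l (fun i => a i + b i)).
Proof.
elim: l => [|i l [K IHl]].
  by exists 0 => a b; rewrite /ordered_prod !big_nil mulg1; apply: close_refl.
have [K' cK'] := zpow_ordered_prod_close l i.
exists (K' + K + D) => a b.
rewrite /ordered_prod !big_cons -!/(ordered_prod l _) zpowD.
(* The intermediate element arises by moving [zpow (x i) (b i)] to the left past
   [ordered_prod l a]. *)
apply: (@close_trans _ _ (zpow (x i) (a i) * zpow (x i) (b i)
  * (ordered_prod l a * ordered_prod l b))%g); last exact: close_mull.
rewrite -!mulgA; apply: close_mull; rewrite !mulgA.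
by apply: close_mulr; apply/close_sym.
Qed.

Variables (l : seq I) (e : G -> I -> int).
Hypothesis eM : forall g h i, e (g * h)%g i = e g i + e h i.
Hypothesis eN : forall g, (g / ordered_prod l (e g))%g \in N.

Lemma section_quasimorphism :
  let f g := F (g / ordered_prod l (e g))%g in
  exists D', forall g h, `|f (g * h)%g - f g - f h| <= D'.
Proof.
move=> f; have [K cK] := ordered_prodD_close l.
exists (2 * D + K) => g h; rewrite /f.
have -> : e (g * h)%g = fun i => e g i + e h i by apply/funext => i.
have [] := cK (e g) (e h); set s := ordered_prod l (e g).
set t := ordered_prod l (e h); set r := ordered_prod l _ => rN rK.
have gN := eN g; have hN := eN h; rewrite -/s -/t in gN hN *.
(* The last factor is the cocycle of the section, where [F] is bounded by [K]; the conjugate has the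
   same value of [F] as [h / t], and splitting the two products costs [2 * D]. *)
have E : (g * h / r = (g / s) * ((s * (h / t) * s^-1) * (s * t / r)))%g.
  by rewrite !mulgA !mulgVK.
have hsN := Nconj s hN.
have := FM gN (gpredM _ _ hsN rN); rewrite -E.
have := FM hsN rN; rewrite FJ //; move: rK; rewrite !ler_norml.
by move=> /andP[? ?] /andP[? ?] /andP[? ?];
  apply/andP; split; lra.
Qed.
End CoarseEquality.

(** * The commutator subgroup and homomorphisms to the integers *)

Section CommutatorSubgroup.
Local Open Scope group_scope.
Variable G : groupType.

Lemma comm_in (x y : G) : x * y / (y * x) \in commutator_subgroup G.
Proof.
(* [[~ x, y]] stands for [x^-1 * y^-1 * x * y], hence the inverses. *)
apply/asboolP => S /(_ x^-1 y^-1); rewrite commgEl conjgE !invgK.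
by rewrite invgM !mulgA.
Qed.

Lemma commutator_conj (g x : G) :
  x \in commutator_subgroup G -> g * x * g^-1 \in commutator_subgroup G.
Proof.
move=> xN; have -> : g * x * g^-1 = (g * x / (x * g)) * x.
  by rewrite invgM !mulgA mulgVK.
by rewrite gpredMr // comm_in.
Qed.

Variable f : G -> int.
Hypothesis fM : forall x y, f (x * y) = (f x + f y)%R.

Definition int_ker : {pred G} := fun x => f x == 0%R.

Let int_ker_closed : group_closed int_ker.
Proof.
split=> [|x y /eqP fx /eqP fy]; apply/eqP.
  by apply/(@addrI _ (f 1)); rewrite -fM mulg1 addr0.
by move: (fM (x / y) y); rewrite mulgVK fx fy addr0 => <-.
Qed.

(** The commutator subgroup is the intersection of all [groupClosed] predicates containing the
    commutators; the kernel of [f] is packed as one of them. *)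
Lemma hom_int_commutator x : x \in commutator_subgroup G -> f x = 0%R.
Proof.
pose mM := isMulClosed.Build G int_ker (group_closedM int_ker_closed).
pose m1 := isMul1Closed.Build G int_ker int_ker_closed.1.
pose mV := isInvClosed.Build G int_ker (group_closedV int_ker_closed).
pose S : groupClosed G := HB.pack int_ker mM m1 mV.
move=> /asboolP/(_ S) h; apply/eqP; apply: h => y z.
have E : f (y * z) = f (z * y) by rewrite !fM addrC.
rewrite -[_ \in S]/(f [~ y, z] == 0%R); apply/eqP/(@addrI _ (f (z * y))).
by rewrite -fM -commgC addr0.
Qed.
End CommutatorSubgroup.

(** * Exponent sums and quadratic Magnus coefficients on the free group *)

Section MagnusCoefficients.
Variable n : nat.
Implicit Types (i j : 'I_n) (a : letter n) (w : seq (letter n)).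
Implicit Types g h : free_group n.

Definition letter_exp i a : int :=
  if a.1 == i then (if a.2 then -1 else 1) else 0.

Definition word_exp i w : int := \sum_(a <- w) letter_exp i a.

(* For [i != j], the coefficient of [X_i X_j] in the Magnus expansion of [w];
   for [i = j] this is not invariant under free reduction. *)
Fixpoint word_magnus i j w : int :=
  if w is a :: w' then word_magnus i j w' + letter_exp i a * word_exp j w'
  else 0.

Lemma letter_expV i a : letter_exp i (linv a) = - letter_exp i a.
Proof. by case: a => k [] /=; rewrite /letter_exp /=; case: eqP. Qed.

Lemma letter_exp_disjoint i j a : i != j -> letter_exp i a * letter_exp j a = 0.
Proof.
rewrite /letter_exp => ij; case: eqP => [->|_]; last by rewrite mul0r.
by rewrite (negPf ij) mulr0.
Qed.

Lemma word_exp_redcons i a w :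
  word_exp i (redcons a w) = letter_exp i a + word_exp i w.
Proof.
rewrite /word_exp; case: w => [|b w] /=; first by rewrite big_cons.
case: eqP => [->|_]; last by rewrite big_cons.
by rewrite big_cons letter_expV addrA subrr add0r.
Qed.

Lemma word_expM i u v : word_exp i (rmul u v) = word_exp i u + word_exp i v.
Proof.
elim: u => [|a u IHu] /=; first by rewrite /word_exp big_nil add0r.
by rewrite word_exp_redcons IHu addrA /word_exp big_cons.
Qed.

(** Cancelling [a] against its inverse leaves, up to sign, [letter_exp i a * letter_exp j a], which
    is [0] for [i != j]. *)
Lemma word_magnus_redcons i j a w : i != j ->
  word_magnus i j (redcons a w) =
  word_magnus i j w + letter_exp i a * word_exp j w.
Proof.
move=> ij; case: w => [|b w] //=; case: eqP => [->|_] //=.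
rewrite /word_exp big_cons !letter_expV mulrDr mulrN letter_exp_disjoint //.
by rewrite mulNr; ring.
Qed.

(** The coefficient of [X_i X_j] in a product of two power series with constant term [1]. *)
Lemma word_magnusM i j u v : i != j ->
  word_magnus i j (rmul u v) =
  word_magnus i j u + word_magnus i j v + word_exp i u * word_exp j v.
Proof.
move=> ij; elim: u => [|a u IHu] /=.
  by rewrite /word_exp big_nil mul0r add0r addr0.
rewrite word_magnus_redcons // IHu word_expM /word_exp big_cons.
by ring.
Qed.

Definition exponent g i : int := word_exp i (val g).
Definition magnus i j g : int := word_magnus i j (val g).

Lemma exponentM g h i : exponent (g * h)%g i = exponent g i + exponent h i.
Proof. exact: word_expM. Qed.

Lemma exponent_commutator g i :
  g \in commutator_subgroup (free_group n) -> exponent g i = 0.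
Proof.
by apply: (@hom_int_commutator _ (exponent^~ i)) => x y; apply: exponentM.
Qed.

Lemma exponent1 i : exponent 1%g i = 0.
Proof. by apply: exponent_commutator; apply: gpred1. Qed.

Lemma exponentV g i : exponent g^-1%g i = - exponent g i.
Proof. by apply/eqP; rewrite -addr_eq0 -exponentM mulVg exponent1. Qed.

Lemma magnusM i j g h : i != j ->
  magnus i j (g * h)%g =
  magnus i j g + magnus i j h + exponent g i * exponent h j.
Proof. exact: word_magnusM. Qed.

(** The commutator has zero exponents, so it contributes no cross term to the product with [h * g],
    which is [g * h]; the difference of the coefficients of [g * h] and [h * g] remains. *)
Lemma magnus_comm i j g h : i != j ->
  magnus i j (g * h / (h * g))%g =
  exponent g i * exponent h j - exponent h i * exponent g j.
Proof.
move=> ij; have := magnusM (g * h / (h * g))%g (h * g)%g ij.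
rewrite mulgVK (exponent_commutator _ (comm_in g h)) !magnusM //.
by move=> E; rewrite mul0r addr0 in E; lia.
Qed.

(** As [x] has zero exponents, the terms from [g] and [g^-1] combine to the coefficient of
    [g * g^-1 = 1]. *)
Lemma magnus_conj i j g x : i != j ->
  x \in commutator_subgroup (free_group n) ->
  magnus i j (g * x * g^-1)%g = magnus i j x.
Proof.
move=> ij xN; have := magnusM g g^-1%g ij; rewrite mulgV => E.
rewrite !magnusM // exponentM !(exponent_commutator _ xN) !addr0 mulr0 addr0.
by rewrite -[RHS]addr0 -[X in _ = _ + X]/(magnus i j 1%g) E; ring.
Qed.

Lemma exponent_gen i j : exponent (fg_gen i) j = (i == j)%:R.
Proof.
by rewrite /exponent /word_exp /= big_seq1 /letter_exp /=; case: eqP.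
Qed.

Lemma exponentX g m i : exponent (g ^+ m)%g i = m%:Z * exponent g i.
Proof.
elim: m => [|m IHm]; first by rewrite exponent1 mul0r.
by rewrite expgS exponentM IHm; lia.
Qed.

Lemma exponent_zpow g (c : int) i : exponent (zpow g c) i = c * exponent g i.
Proof.
case: c => m; first exact: exponentX.
by rewrite /zpow exponentV exponentX NegzE mulNr.
Qed.

Lemma free_group_ind (P : free_group n -> Prop) :
  P 1%g -> (forall i c g, P g -> P (zpow (fg_gen i) c * g)%g) ->
  forall g, P g.
Proof.
move=> P1 PM [w rw].
elim: w rw => [|[i b] w IHw] rw; first by congr P: P1; apply: val_inj.
have := PM i (if b then -1 else 1) _ (IHw (reduced_tl rw)).
congr P; apply: val_inj => /=.
by case: b rw => /=; case: w {IHw} => //= a w /andP[/negPf->].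
Qed.

Lemma ordered_prod_delta i (c : int) :
  ordered_prod (@fg_gen n) (index_enum 'I_n) (fun j => c * (i == j)%:R) =
  zpow (fg_gen i) c.
Proof.
rewrite /ordered_prod (big_only1 i) ?eqxx ?mulr1 // => j ji _.
by rewrite eq_sym (negPf ji) mulr0.
Qed.

Lemma mod_ordered_prod g :
  (g / ordered_prod (@fg_gen n) (index_enum 'I_n) (exponent g))%g
    \in commutator_subgroup (free_group n).
Proof.
set N := commutator_subgroup _; set s := ordered_prod _ _.
(* For this [F], [close] is congruence modulo [N]. *)
pose F (g : free_group n) : rat := 0.
have Nconj := @commutator_conj (free_group n).
have FM (x y : free_group n) : x \in N -> y \in N ->
  `|F (x * y)%g - F x - F y| <= 0 by rewrite !subr0 normr0.
have FJ (h x : free_group n) : x \in N -> F (h * x * h^-1)%g = F x by [].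
have FV (x : free_group n) : x \in N -> F x^-1%g = - F x by rewrite oppr0.
have comm_close i j : exists K, forall a b : int, close N F K
    (zpow (fg_gen i) a * zpow (fg_gen j) b)%g
    (zpow (fg_gen j) b * zpow (fg_gen i) a)%g.
  by exists 0 => a b; split; [apply: comm_in | rewrite normr0].
have [K sD] := ordered_prodD_close Nconj FM FJ FV comm_close (index_enum 'I_n).
have cong0 u v : (u / v)%g \in N -> close N F 0 u v.
  by split=> //; rewrite normr0.
elim/free_group_ind: g => [|i c g IHg].
  have -> : exponent 1%g = fun i => 0 * (i == i)%:R.
    by apply/funext => i; rewrite exponent1 mul0r.
  by rewrite /s /ordered_prod big1 => [|i _]; rewrite ?mul0r // mulgV gpred1.
have [] : close N F (0 + K + 0) (zpow (fg_gen i) c * g)%g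
    (s (exponent (zpow (fg_gen i) c * g)%g)) => //.
(* Induction replaces [g] by [s (exponent g)]; the new power is itself a value of [s], so additivity
   of [s] modulo [N] concludes. *)
apply: (close_trans FM (close_mull Nconj FJ _ (cong0 _ _ IHg))).
have := sD (fun j => c * (i == j)%:R) (exponent g).
rewrite ordered_prod_delta; congr (close _ _ _ _ (s _)).
by apply/funext => j; rewrite exponentM exponent_zpow exponent_gen.
Qed.
End MagnusCoefficients.

(** * Bases indexed by finite types, quotient spaces, and the number of increasing pairs *)

Lemma has_dim_fintype (R : fieldType) (V : lmodType R) (I : finType)
  (b : I -> V) :
  (forall c : I -> R, \sum_i c i *: b i = 0 -> forall i, c i = 0) ->
  (forall v, exists c : I -> R, v = \sum_i c i *: b i) -> has_dim V #|I|.
Proof.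
move=> b_free b_span; exists (b \o enum_val); split=> [c c0 k|v].
  rewrite -(enum_valK k); apply: (b_free (c \o enum_rank)).
  rewrite (reindex _ (onW_bij _ (enum_val_bij I))) /=.
  by rewrite -[RHS]c0; apply: eq_bigr => i _; rewrite enum_valK.
have [c ->] := b_span v; exists (c \o enum_val).
by rewrite (reindex _ (onW_bij _ (enum_val_bij I))).
Qed.

Lemma quotsp_pi_eq0 (R : fieldType) (V : lmodType R) (W : submodClosed V) v :
  quotsp_pi W v = 0 <-> v \in W.
Proof.
have <- : quotsp_pi W 0 = 0.
  by apply: (addrI (quotsp_pi W 0)); rewrite -quotsp_piD !addr0.
by rewrite quotsp_piE subr0.
Qed.

Lemma quotsp_pi_sum (R : fieldType) (V : lmodType R) (W : submodClosed V)
  (I : finType) (c : I -> R) (v : I -> V) :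
  quotsp_pi W (\sum_i c i *: v i) = \sum_i c i *: quotsp_pi W (v i).
Proof.
have pi0 : quotsp_pi W 0 = 0 by apply/quotsp_pi_eq0; apply: rpred0.
rewrite (big_morph _ (@quotsp_piD _ _ W) pi0).
by apply: eq_bigr => i _; rewrite quotsp_piZ.
Qed.

Definition increasing_pair n := {p : 'I_n * 'I_n | (p.1 < p.2)%N}.

(** Pairs are counted by their larger entry [j], which occurs [j] times. *)
Lemma card_increasing_pair n :
  #|{: increasing_pair n}| = ((n * (n - 1)) %/ 2)%N.
Proof.
rewrite card_sig subn1 divn2 -bin2 -bin2_sum -sum1_card.
rewrite -(pair_big_dep predT (fun i j : 'I_n => i < j)%N (fun _ _ => 1%N)) /=.
rewrite (exchange_big_dep predT) //= big_mkord; apply: eq_bigr => j _.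
by rewrite (big_ord_narrow (ltnW (ltn_ord j))) sum1_card card_ord.
Qed.

(** * Extension from [N] to [G], and the Magnus homomorphisms as obstructions *)

Section Extension.
Variables (R : realType) (n : nat).
Local Notation G := (free_group n).
Local Notation N := (commutator_subgroup G).
Local Notation Q := (@QNG R G N).
Implicit Type f : Q.

(* Outside [N] the value is [f 1], which is [0] by homogeneity. *)
Definition zero_ext f (g : G) : R := val f (insubd (1%g : subgroup N) g).

Lemma zero_ext_val f (x : subgroup N) : zero_ext f (val x) = val f x.
Proof. by rewrite /zero_ext valKd. Qed.

Lemma zero_extM f : exists D, forall x y, x \in N -> y \in N ->
  `|zero_ext f (x * y)%g - zero_ext f x - zero_ext f y| <= D.
Proof.
have /andP[/asboolP[[D fD] _] _] := valP f; exists D => x y xN yN.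
have := fD (exist _ x xN) (exist _ y yN).
by rewrite -!zero_ext_val.
Qed.

Lemma zero_extX f x m : x \in N ->
  zero_ext f (x ^+ m)%g = m%:R * zero_ext f x.
Proof.
move=> xN; have /andP[fQ _] := valP f.
have := hqmX (exist _ x xN : subgroup N) m fQ; rewrite -!zero_ext_val => <-.
by congr zero_ext; rewrite gmulfXn.
Qed.

Lemma zero_extV f x : x \in N -> zero_ext f x^-1%g = - zero_ext f x.
Proof.
move=> xN; have /andP[fQ _] := valP f.
by have := hqmV (exist _ x xN : subgroup N) fQ; rewrite -!zero_ext_val.
Qed.

Lemma zero_extJ f g x : x \in N -> zero_ext f (g * x * g^-1)%g = zero_ext f x.
Proof.
move=> xN; have /andP[_ /asboolP fi] := valP f.
have yN := commutator_conj g xN.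
have := fi g (exist _ x xN) (exist (fun z => z \in N) _ yN) erefl.
by rewrite -!zero_ext_val.
Qed.

Lemma zero_extD f f' g : zero_ext (f + f') g = zero_ext f g + zero_ext f' g.
Proof. by []. Qed.

Lemma zero_extZ a f g : zero_ext (a *: f) g = a * zero_ext f g.
Proof. by []. Qed.

Lemma zero_ext_sum (I : finType) (f : I -> Q) g :
  zero_ext (\sum_i f i) g = \sum_i zero_ext (f i) g.
Proof.
exact: (big_morph (zero_ext^~ g) (fun f f' => zero_extD f f' g) erefl).
Qed.

Lemma extendable_of_bounded f :
  (forall i j : 'I_n, exists K, forall a b : int,
    `|zero_ext f (zpow (fg_gen i) a * zpow (fg_gen j) b /
                  (zpow (fg_gen j) b * zpow (fg_gen i) a))%g| <= K) ->
  f \in iQG R N.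
Proof.
move=> f_bd; have [D FM] := zero_extM f.
have comm_close i j : exists K, forall a b : int, close N (zero_ext f) K
    (zpow (fg_gen i) a * zpow (fg_gen j) b)%g
    (zpow (fg_gen j) b * zpow (fg_gen i) a)%g.
  by have [K fK] := f_bd i j; exists K => a b; split; first exact: comm_in.
have := section_quasimorphism (@commutator_conj G) FM (@zero_extJ f)
  (@zero_extV f) comm_close (@exponentM n) (@mod_ordered_prod n).
set phi := fun g => zero_ext f _ => phi_qm.
have [h hQ [C hC]] := quasimorphism_near_hqm phi_qm.
apply/asboolP; exists h => //; apply/funext => x /=.
apply/eqP; rewrite -subr_eq0; apply/eqP/(@bounded_multiples_eq0 _ _ C) => m.
have xN : val x \in N := valP x.
have := hC (val x) m; rewrite /phi.
(* Powers of [x] stay in [N], where the exponents vanish and the section is [1]. Hence [phi] takes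
   the value [m * f x] at the [m]-th power, and [C] bounds all multiples of [f x - h x]. *)
have -> : exponent (val x ^+ m)%g = fun=> 0.
  by apply/funext => i; rewrite exponent_commutator // gpredXn.
rewrite /ordered_prod big1 // invg1 mulg1 zero_extX // zero_ext_val.
by rewrite -mulrBr normrM normr_nat.
Qed.

Definition magnus_res (p : increasing_pair n) (x : subgroup N) : R^o :=
  (magnus (val p).1 (val p).2 (val x))%:~R.

Lemma increasing_pair_neq (p : increasing_pair n) : (val p).1 != (val p).2.
Proof. by apply: contraTneq (valP p) => ->; rewrite ltnn. Qed.

Lemma magnus_res_hom p : invariant_hom (magnus_res p).
Proof.
split=> [x y|g x y] ; rewrite /magnus_res.
  rewrite magnusM ?increasing_pair_neq // exponent_commutator ?(valP x) //.
  by rewrite mul0r addr0 intrD.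
by move=> ->; rewrite magnus_conj ?increasing_pair_neq ?(valP x).
Qed.

Definition magnus_hqm p : Q :=
  exist _ (magnus_res p) (invariant_hom_hqm (magnus_res_hom p)).

Lemma zero_ext_magnus p g h :
  zero_ext (magnus_hqm p) (g * h / (h * g))%g =
  (exponent g (val p).1 * exponent h (val p).2 -
   exponent h (val p).1 * exponent g (val p).2)%:~R.
Proof.
rewrite /zero_ext /= /magnus_res insubdK ?comm_in //.
by rewrite magnus_comm ?increasing_pair_neq.
Qed.

(** The Magnus homomorphisms are dual to the commutators of generators: both pairs being increasing,
    the transposed term of [zero_ext_magnus] vanishes. *)
Lemma zero_ext_magnus_gen (p q : increasing_pair n) (a b : int) :
  zero_ext (magnus_hqm p)
    (zpow (fg_gen (val q).1) a * zpow (fg_gen (val q).2) b /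
     (zpow (fg_gen (val q).2) b * zpow (fg_gen (val q).1) a))%g =
  (p == q)%:R * a%:~R * b%:~R.
Proof.
rewrite zero_ext_magnus !exponent_zpow !exponent_gen.
have -> : (p == q) = ((val q).1 == (val p).1) && ((val q).2 == (val p).2).
  by rewrite eq_sym -val_eqE -pair_eqE.
case: p q => [[i j] /= ij] [[k l] /= kl].
have lkF : (l == i) && (k == j) = false.
  by apply/negP => /andP[/eqP li /eqP kj]; subst; lia.
rewrite mulrACA -natrM mulnb [X in _ - X]mulrACA -natrM mulnb lkF mulr0 subr0.
by rewrite !intrM rmorph_nat mulrC mulrA.
Qed.

Lemma magnus_hqm_not_extendable (c : increasing_pair n -> R) :
  \sum_p c p *: magnus_hqm p \in iQG R N -> forall p, c p = 0.
Proof.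
move=> /asboolP[h hQ hE] p; have [D hD] := hqm_comm_bounded hQ.
have hF g : g \in N -> h g = \sum_p c p * zero_ext (magnus_hqm p) g.
  move=> gN; transitivity (zero_ext (\sum_p c p *: magnus_hqm p) g).
    by rewrite /zero_ext hE; congr h; rewrite insubdK.
  by rewrite zero_ext_sum.
apply: (@bounded_multiples_eq0 _ _ D) => m.
pose x := zpow (fg_gen (val p).1) m.
pose y := zpow (fg_gen (val p).2) m.
have := hD x y; rewrite hF ?comm_in //.
under eq_bigr => q _ do rewrite zero_ext_magnus_gen.
rewrite (bigD1 p) //= eqxx big1 => [|q qp]; last first.
  by rewrite (negPf qp) !mul0r mulr0.
rewrite addr0 mul1r normrM -pmulrn -natrM normr_nat mulrC.
(* The bounded quantity is [m * m] times the absolute value of [c p], and [m <= m * m] gives the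
   linear bound. *)
apply: le_trans; rewrite ler_wpM2r // ler_nat.
by case: m {x y} => // m; rewrite leq_pmulr.
Qed.

Lemma magnus_hqm_span_mod_extendable (f : Q) :
  exists c : increasing_pair n -> R,
    f - \sum_p c p *: magnus_hqm p \in iQG R N.
Proof.
have [D FM] := zero_extM f.
have /choice[c cP] (p : increasing_pair n) : exists lam, exists K,
    forall a b : int,
    `|zero_ext f (zpow (fg_gen (val p).1) a * zpow (fg_gen (val p).2) b /
       (zpow (fg_gen (val p).2) b * zpow (fg_gen (val p).1) a))%g
      - lam * a%:~R * b%:~R| <= K.
  set x := fg_gen _; set y := fg_gen _.
  apply: (@quasibilinear_int _ _ D) => [a a' b|a b b'].
    rewrite zpowD; set u := zpow x a; set u' := zpow x a'; set v := zpow y b.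
    (* The commutator of a product is a product of a conjugated commutator and a commutator;
       invariance removes the conjugation, leaving one defect. *)
    have -> : (u * u' * v / (v * (u * u')) =
      (u * (u' * v / (v * u')) * u^-1) * (u * v / (v * u)))%g.
      by rewrite !invgM !mulgA !mulgVK.
    rewrite [_ - _ - _]addrAC -(zero_extJ f u (comm_in u' v)).
    by apply: FM; rewrite ?commutator_conj ?comm_in.
  rewrite zpowD; set u := zpow x a; set v := zpow y b; set v' := zpow y b'.
  have -> : (u * (v * v') / (v * v' * u) =
    (u * v / (v * u)) * (v * (u * v' / (v' * u)) * v^-1))%g.
    by rewrite !invgM !mulgA !mulgVK.
  rewrite -(zero_extJ f v (comm_in u v')).
  by apply: FM; rewrite ?commutator_conj ?comm_in.
exists c; set f' := f - _.
have f'_bd (i j : 'I_n) : (i < j)%N -> exists K, forall a b : int,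
    `|zero_ext f' (zpow (fg_gen i) a * zpow (fg_gen j) b /
                  (zpow (fg_gen j) b * zpow (fg_gen i) a))%g| <= K.
  move=> ij; have [K cK] := cP (exist _ (i, j) ij); exists K => a b.
  have := cK a b => /=; congr (`|_| <= _).
  rewrite /f' -scaleN1r zero_extD zero_extZ mulN1r zero_ext_sum.
  congr (_ - _); rewrite (bigD1 (exist _ (i, j) ij)) //= big1 => [|q qp].
    by rewrite zero_extZ (zero_ext_magnus_gen _ (exist _ (i, j) ij)) eqxx
      mul1r addr0 mulrA.
  by rewrite zero_extZ (zero_ext_magnus_gen _ (exist _ (i, j) ij))
    (negPf qp) !mul0r mulr0.
apply: extendable_of_bounded => i j.
(* Exchanging [i] and [j] inverts the commutator and only changes the sign; for [i = j] the powers
   commute and the value is that at [1]. *)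
have [ij|ji|/val_inj ->] := ltngtP i j; first exact: f'_bd.
  have [K fK] := f'_bd j i ji; exists K => a b.
  by rewrite -invgF zero_extV ?comm_in // normrN.
exists `|zero_ext f' 1%g| => a b.
by rewrite -!zpowD addrC mulgV.
Qed.
End Extension.

(** * Dimensions of the two quotients *)

Theorem theorem4p5 (R : realType) (n : nat) (hn : (1 <= n)%N) :
  has_dim (quotsp (iQG R (commutator_subgroup (free_group n))))
    ((n * (n - 1)) %/ 2)%N
  /\
  has_dim (quotsp (sumsp (H1NG R (commutator_subgroup (free_group n)))
                         (iQG R (commutator_subgroup (free_group n))))) 0.
Proof.
split; last first.
  (* The basis is empty, so every class has to vanish: a representative is a combination of Magnus
     homomorphisms plus an extendable remainder. *)
  exists (fun _ => 0); split=> [c _ []//|v]; exists (fun _ => 0).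
  rewrite big_ord0; have [f ->] := quotsp_piP v.
  have [c cP] := magnus_hqm_span_mod_extendable f.
  apply/quotsp_pi_eq0/asboolP; exists (\sum_p c p *: magnus_hqm R p).
  exists (f - \sum_p c p *: magnus_hqm R p); split=> //; last first.
    by rewrite addrC subrK.
  apply: rpred_sum => p _; apply: rpredZ; apply/asboolP.
  exact: magnus_res_hom.
rewrite -card_increasing_pair.
apply: (has_dim_fintype (b := fun p => quotsp_pi _ (magnus_hqm R p))) => [c|v].
  rewrite -quotsp_pi_sum => /quotsp_pi_eq0.
  exact: magnus_hqm_not_extendable.
have [f ->] := quotsp_piP v; have [c cP] := magnus_hqm_span_mod_extendable f.
by exists c; rewrite -quotsp_pi_sum; apply/quotsp_piE.
Qed.
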